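(* Let $\mathcal{H}$ be a complex Hilbert space, let $n$ be a positive integer, let $S_1,\dots,S_n\in\mathcal{B}(\mathcal{H})$, let $q\in(0,1]$, and let $\alpha=e^{\pi \mathrm{i}/(2n)}$ and $\omega=e^{2\pi \mathrm{i}/n}$, where $\mathrm{i}$ is the imaginary unit. Let $\mathbb{S}_{circ_{\mathrm{i}}}$ be the imaginary circulant operator matrix $$\mathbb{S}_{circ_{\mathrm{i}}}=\begin{bmatrix} S_1 & S_2 & S_3 & \cdots & S_n\\ \mathrm{i}S_n & S_1 & S_2 & \cdots & S_{n-1}\\ \mathrm{i}S_{n-1} & \mathrm{i}S_n & S_1 & \ddots & S_{n-2}\\ \vdots & \vdots & \ddots & \ddots & \vdots\\ \mathrm{i}S_2 & \mathrm{i}S_3 & \cdots & \mathrm{i}S_n & S_1\end{bmatrix}$$ acting on $\bigoplus_{j=1}^n\mathcal{H}$. Then $$\max_{0\le k\le n-1} w_q\left(\sum_{j=1}^n(\alpha\omega^k)^{j-1}S_j\right)\le w_q(\mathbb{S}_{circ_{\mathrm{i}}})\le \frac{q+2\sqrt{1-q^2}}{q}\max_{0\le k\le n-1} w_q\left(\sum_{j=1}^n(\alpha\omega^k)^{j-1}S_j\right).$$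
   Context: $\mathcal{B}(\mathcal{K})$ denotes the bounded linear operators on a complex Hilbert space $\mathcal{K}$. An $n\times n$ matrix $[S_{ij}]$ with entries in $\mathcal{B}(\mathcal{H})$ acts on $\bigoplus_{j=1}^n\mathcal{H}$ (with the direct-sum inner product) by $(x_1,\dots,x_n)\mapsto(\sum_j S_{1j}x_j,\dots,\sum_j S_{nj}x_j)$. For $A\in\mathcal{B}(\mathcal{K})$ and a scalar $q$ with $|q|\le 1$, the $q$-numerical range is $W_q(A)=\{\langle Ax,y\rangle: x,y\in\mathcal{K},\ \|x\|=\|y\|=1,\ \langle x,y\rangle=q\}$ and the $q$-numerical radius is $w_q(A)=\sup\{|z|: z\in W_q(A)\}$. In the degenerate case $\dim\mathcal{K}=1$, where $A$ is a scalar $c$ and $W_q(A)$ is empty for $0<q<1$, the convention is $w_q(A)=q|c|$. *)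

(* Defs.v *)
From HB Require Import structures.
From mathcomp Require Import all_boot all_order all_algebra sesquilinear.
From mathcomp Require Import complex ring.
From mathcomp Require Import all_classical all_reals all_analysis.

Set Implicit Arguments.
Unset Strict Implicit.
Unset Printing Implicit Defensive.

Import Order.TTheory GRing.Theory Num.Theory.
Import numFieldNormedType.Exports.

Local Open Scope classical_set_scope.
Local Open Scope ring_scope.
Section DotNorm.
Variables (C : numClosedFieldType) (U : lmodType C).
Variable f : {dot U for Num.conj}.

Lemma dot_CauchySchwarz u v : `|f u v| ^+ 2 <= f u u * f v v.
Proof.
have [->|v0] := eqVneq v 0; first by rewrite !linear0r normr0 expr0n.
have vv : 0 < f v v by rewrite dnorm_gt0.
have vvR : (f v v)^* = f v v by apply/CrealP/ger0_real/ltW.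
set a := f u v.
have : 0 <= f (f v v *: u - a *: v) (f v v *: u - a *: v) by exact: dnorm_ge0.
rewrite dnormB !dnormZ !(linearZl_LR f) !(linearZr_LR f) /= -/a (ger0_norm (ltW vv)).
rewrite !rmorphM /= conjCK vvR.
have -> : f v v ^+ 2 * f u u + `|a| ^+ 2 * f v v
    - (f v v * (a^* * a) + f v v * (a * a^*))
  = f v v * (f u u * f v v - `|a| ^+ 2) by rewrite normCK; ring.
by rewrite pmulr_rge0 // subr_ge0.
Qed.

Lemma dot_normD u v :
  sqrtC (f (u + v) (u + v)) <= sqrtC (f u u) + sqrtC (f v v).
Proof.
have uu := dnorm_ge0 f u; have vv := dnorm_ge0 f v.
have suv : 0 <= sqrtC (f u u) + sqrtC (f v v) by rewrite addr_ge0 ?sqrtC_ge0.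
rewrite -(ler_pXn2r (ltn0Sn 1)) ?nnegrE ?sqrtC_ge0 ?dnorm_ge0 //.
rewrite sqrrD !sqrtCK dnormD [leRHS]addrAC lerD2l -sqrtCM ?nnegrE //.
have fR : f u v + (f u v)^* \is Num.real.
  by rewrite CrealE rmorphD /= conjCK addrC.
apply: (le_trans (real_ler_norm fR)); apply: (le_trans (ler_normD _ _)).
rewrite norm_conjC -mulr2n ler_pMn2r //.
rewrite -(ler_pXn2r (ltn0Sn 1)) ?nnegrE ?sqrtC_ge0 ?mulr_ge0 //.
by rewrite sqrtCK dot_CauchySchwarz.
Qed.

Lemma dot_normZ a u : sqrtC (f (a *: u) (a *: u)) = `|a| * sqrtC (f u u).
Proof.
by rewrite dnormZ sqrtCM ?nnegrE ?exprn_ge0 ?dnorm_ge0 // sqrCK.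
Qed.

End DotNorm.

Local Open Scope complex_scope.

(* [{dot V for Num.conj}] is linear in its first argument, conjugate-linear in
   the second one, and positive definite. *)
HB.mixin Record isHilbert (R : realType) V of CompleteNormedModule R[i] V := {
  inner : {dot V for Num.conj};
  inner_normE : forall x : V, inner x x = `|x| ^+ 2
}.

#[short(type="hilbertType")]
HB.structure Definition Hilbert (R : realType) :=
  {V of CompleteNormedModule R[i] V & isHilbert R V}.

Section DirectSum.
Variables (R : realType) (n : nat) (H : hilbertType R).

Definition hsum : Type := {ffun 'I_n -> H}.
HB.instance Definition _ := GRing.Lmodule.on hsum.

Definition hsum_inner (x y : hsum) : R[i] := \sum_i inner (x i) (y i).

Lemma hsum_inner_bilinear : bilinear_for *%R (Num.conj \; *%R) hsum_inner.
Proof.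
split=> [u'|u] a x y; rewrite /hsum_inner /= ?mulr_sumr -big_split /=;
  apply: eq_bigr => i _; rewrite !ffunE.
  by rewrite linearDl linearZl_LR.
by rewrite linearDr linearZr_LR.
Qed.

HB.instance Definition _ :=
  bilinear_isBilinear.Build R[i] hsum hsum R[i] *%R (Num.conj \; *%R)
    hsum_inner hsum_inner_bilinear.

Lemma hsum_inner_herm x y :
  hsum_inner x y = (-1) ^+ false * Num.conj (hsum_inner y x).
Proof.
rewrite mul1r /hsum_inner rmorph_sum; apply: eq_bigr => i _.
by rewrite hermC mul1r.
Qed.

HB.instance Definition _ := isHermitianSesquilinear.Build
  R[i] hsum false Num.conj hsum_inner hsum_inner_herm.

Lemma hsum_inner_gt0 (x : hsum) : x != 0 -> 0 < hsum_inner x x.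
Proof.
move=> x0; rewrite /hsum_inner.
have h i : 0 <= inner (x i) (x i) by exact: dnorm_ge0.
rewrite lt_def sumr_ge0 ?andbT //; apply: contra x0 => /eqP s0.
apply/eqP/ffunP => i; rewrite ffunE; apply/eqP.
by rewrite -(dnorm_eq0 inner) (psumr_eq0P (fun i _ => h i) s0).
Qed.

HB.instance Definition _ := isDotProduct.Build
  R[i] hsum hsum_inner hsum_inner_gt0.

Definition hsum_norm (x : hsum) : R[i] := sqrtC (hsum_inner x x).

Lemma hsum_normr0_eq0 x : hsum_norm x = 0 -> x = 0.
Proof. by move/eqP; rewrite sqrtC_eq0 dnorm_eq0 => /eqP. Qed.

HB.instance Definition _ := Lmodule_isNormed.Build R[i] hsum
  (dot_normD hsum_inner) (dot_normZ hsum_inner) hsum_normr0_eq0.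

Lemma hsum_normE (x : hsum) : `|x| = sqrtC (\sum_i `|x i| ^+ 2).
Proof.
by congr sqrtC; apply: eq_bigr => i _; rewrite inner_normE.
Qed.

Lemma hsum_norm_ge (x : hsum) i : `|x i| <= `|x|.
Proof.
rewrite -(ler_pXn2r (ltn0Sn 1)) ?nnegrE // hsum_normE sqrtCK (bigD1 i) //=.
by rewrite lerDl sumr_ge0 // => j _; rewrite exprn_ge0.
Qed.

Lemma hsum_norm_le (x : hsum) : `|x| <= \sum_i `|x i|.
Proof.
rewrite -(ler_pXn2r (ltn0Sn 1)) ?nnegrE ?sumr_ge0 // hsum_normE sqrtCK.
rewrite expr2 mulr_suml; apply: ler_sum => i _.
by rewrite expr2 ler_wpM2l // (bigD1 i) //= lerDl sumr_ge0.
Qed.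

Lemma hsum_complete (F : set_system hsum) : ProperFilter F -> cauchy F -> cvg F.
Proof.
move=> FF /cauchy_ballP Fc.
have cvF i : cvg ((fun x : hsum => x i) @ F).
  apply: cauchy_cvg; apply/cauchy_ballP => e e0.
  rewrite near_simpl near_map2; apply: filterS (Fc _ e0) => -[x y].
  rewrite /= -!ball_normE /= => xy; apply: le_lt_trans xy.
  by have := hsum_norm_ge (x - y) i; rewrite !ffunE.
pose l : hsum := [ffun i => lim ((fun x : hsum => x i) @ F)].
apply/cvg_ex; exists l; apply/cvgrPdist_lt => e e0.
have d0 : 0 < e / n.+1%:R by rewrite divr_gt0.
have : F [set x : hsum | forall i, `|l i - x i| < e / n.+1%:R].
  apply: filter_forall => i; have /cvgrPdist_lt := cvF i.
  by move=> /(_ _ d0); rewrite /l ffunE.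
apply: filterS => x hx; apply: le_lt_trans (hsum_norm_le _) _.
apply: (@le_lt_trans _ _ (\sum_(i < n) e / n.+1%:R)).
  by apply: ler_sum => i _; rewrite !ffunE; have := hx i; rewrite ffunE => /ltW.
rewrite sumr_const card_ord -[_ *+ n]mulr_natr mulrAC -mulrA gtr_pMr //.
by rewrite ltr_pdivrMr // mul1r ltr_nat.
Qed.

HB.instance Definition _ := Uniform_isComplete.Build hsum hsum_complete.

Lemma hsum_inner_normE (x : hsum) : hsum_inner x x = `|x| ^+ 2.
Proof. by rewrite sqrtCK. Qed.

HB.instance Definition _ := isHilbert.Build R hsum hsum_inner_normE.

End DirectSum.
Section NumericalRange.
Variables (R : realType) (K : hilbertType R).
Implicit Types (A : K -> K) (q : R[i]).

Definition qnum_range q A : set R[i] :=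
  [set z | exists x y : K,
    [/\ `|x| = 1, `|y| = 1, inner x y = q & z = inner (A x) y]].

Definition dim_one : Prop :=
  exists2 e : K, e != 0 & forall x : K, exists a : R[i], x = a *: e.

(* Only meaningful for A linear and K of dimension one. *)
Definition scalar_of A : R[i] := xget 0 [set c | forall x, A x = c *: x].

(* When dim K = 1, the set qnum_range q A is empty for |q| < 1 and the radius is
   |q||c| by convention, where A = c I; for |q| = 1 this agrees with the
   supremum. Norms in R[i] live in R[i], hence complex.Re. On the zero space
   qnum_range q A is empty and sup set0 = 0. *)
Definition qnum_radius q A : R :=
  if `[< dim_one >] then complex.Re `|q| * complex.Re `|scalar_of A|
  else sup [set complex.Re `|z| | z in qnum_range q A].

End NumericalRange.

Definition bounded_op (R : realType) (K : hilbertType R) (A : K -> K) : Prop :=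
  bounded_near A (nbhs (0 : K)).

(* e^(it) for real t, by Euler's formula. *)
Definition expi (R : realType) (t : R) : R[i] := cos t +i* sin t.

Section Circulant.
Variables (R : realType) (n : nat) (H : hilbertType R).

Definition opmx_act (S : 'I_n -> 'I_n -> H -> H) (x : hsum n H) : hsum n H :=
  [ffun i => \sum_j S i j (x j)].

Lemma circ_index_subproof (i j : 'I_n) : ((j + (n - i)) %% n < n)%N.
Proof. by rewrite ltn_pmod // (leq_ltn_trans _ (ltn_ord i)). Qed.

(* j - i modulo n, that is j - i if i <= j and n + j - i otherwise. *)
Definition circ_index (i j : 'I_n) : 'I_n := Ordinal (circ_index_subproof i j).

(* Indices start from 0: S 0, ..., S (n - 1) is the first row. *)
Definition circ_i (S : 'I_n -> H -> H) (i j : 'I_n) : H -> H := fun x =>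
  if (i <= j)%N then S (circ_index i j) x else 'i *: S (circ_index i j) x.

End Circulant.

(* Main.v *)
Require Import Defs.
From HB Require Import structures.
From mathcomp Require Import all_boot all_order all_algebra sesquilinear.
From mathcomp Require Import complex ring lra zify.
From mathcomp Require Import all_classical all_reals all_analysis.

Set Implicit Arguments.
Unset Strict Implicit.
Unset Printing Implicit Defensive.

Import Order.TTheory GRing.Theory Num.Theory.
Import numFieldNormedType.Exports.

Local Open Scope classical_set_scope.
Local Open Scope ring_scope.
Local Open Scope complex_scope.

(** Put A for the imaginary circulant, l_k = alpha * omega^k and
    T_k = \sum_j l_k^j S_j. The numbers l_0, ..., l_(n-1) are the n-th roots of
    the imaginary unit, which is why the factor picked up by an entry of A that
    wraps around the diagonal is l_k^n; hence A maps
    J_k x = n^(-1/2) (x, l_k x, ..., l_k^(n-1) x) to J_k (T_k x)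
    ([circ_geom_embed]). Each J_k is an isometry ([geom_embed_isometry]) and,
    the l_k being equally spaced on the unit circle, the J_k split the direct
    sum completely ([geom_embed_complete]): A is the direct sum of the T_k.

    Lower bound. An isometry that intertwines two operators carries the
    q-numerical range of the first one into that of the second one
    ([qnum_radius_isometry]).

    Upper bound. Write w(B) for the supremum of |<Bx,x>| over unit vectors x.
    - q w(B) <= w_q(B), because q<Bx,x> is the midpoint of the two values
      <Bx, qx + sz> and <Bx, qx - sz> with z a unit vector orthogonal to x and
      s = sqrt(1 - q^2) ([mul_num_radius_le]).
    - w_q(B) <= (q + 2s) w(B), since <Bx,y> = q<Bx,x> + <Bx,y - qx> with
      |y - qx| = s, and the norm of B is at most 2 w(B) by polarization
      ([qnum_radius_le]).
    - w(A) <= max_k w(T_k), because <Ay,y> is the sum of the <T_k u_k,u_k> over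
      the components u_k of y ([num_radius_decomposition]).
    The three together give w_q(A) <= (q + 2s) / q * max_k w_q(T_k).

    In a one-dimensional space no z orthogonal to x exists and w_q(B) is given
    by the convention q|c|; the bounds that compare w and w_q treat this case
    separately. *)

(** * Inner products and norms *)

Section Inner.
Variables (R : realType) (K : hilbertType R).
Implicit Types x y z : K.

Lemma Re_normK (z : R[i]) : (complex.Re `|z|)%:C = `|z|.
Proof. exact/RRe_real/normr_real. Qed.

Lemma Re_norm_ge0 (z : R[i]) : 0 <= complex.Re `|z|.
Proof. by rewrite -lecR Re_normK; exact: normr_ge0. Qed.

Lemma Re_normMK (a b : R[i]) :
  (complex.Re `|a| * complex.Re `|b|)%:C = `|a| * `|b|.
Proof. by rewrite rmorphM /= !Re_normK. Qed.

Lemma innerC x y : inner x y = Num.conj (inner y x).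
Proof. by rewrite hermC expr0 mul1r. Qed.

Lemma innerZl a x y : inner (a *: x) y = a * inner x y.
Proof. exact: linearZl_LR. Qed.

Lemma innerZr a x y : inner x (a *: y) = Num.conj a * inner x y.
Proof. exact: linearZr_LR. Qed.

Lemma innerDl x y z : inner (x + y) z = inner x z + inner y z.
Proof. exact: linearDl. Qed.

Lemma innerDr x y z : inner x (y + z) = inner x y + inner x z.
Proof. exact: linearDr. Qed.

Lemma innerBl x y z : inner (x - y) z = inner x z - inner y z.
Proof. exact: linearBl. Qed.

Lemma innerBr x y z : inner x (y - z) = inner x y - inner x z.
Proof. exact: linearBr. Qed.

Lemma inner_suml I (r : seq I) (P : pred I) (F : I -> K) y :
  inner (\sum_(i <- r | P i) F i) y = \sum_(i <- r | P i) inner (F i) y.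
Proof. exact: linear_sumlz. Qed.

Lemma inner_sumr I (r : seq I) (P : pred I) (F : I -> K) x :
  inner x (\sum_(i <- r | P i) F i) = \sum_(i <- r | P i) inner x (F i).
Proof. exact: linear_sumr. Qed.

Lemma inner_le x y : `|inner x y| <= `|x| * `|y|.
Proof.
rewrite -(ler_pXn2r (ltn0Sn 1)) ?nnegrE ?mulr_ge0 //.
by rewrite exprMn -!inner_normE dot_CauchySchwarz.
Qed.

Lemma norm1_inner x : `|x| = 1 -> inner x x = 1.
Proof. by move=> x1; rewrite inner_normE x1 expr1n. Qed.

Lemma inner_norm1 x : inner x x = 1 -> `|x| = 1.
Proof.
rewrite inner_normE => x1; apply/eqP.
by rewrite -(@pexpr_eq1 _ _ 2) // x1.
Qed.

Lemma ex_normalized x : x != 0 -> exists a : R[i], `|a *: x| = 1.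
Proof.
move=> x0; have nx0 : `|x| != 0 by rewrite normr_eq0.
by exists `|x|^-1; rewrite normrZ ger0_norm ?invr_ge0 // mulVf.
Qed.

Lemma ex_unit_orthogonal x : `|x| = 1 -> ~ dim_one K ->
  exists2 z, `|z| = 1 & inner x z = 0.
Proof.
move=> x1 Kn1; have x0 : x != 0 by rewrite -normr_eq0 x1 oner_neq0.
have [v vx] : exists v, forall a : R[i], v <> a *: x.
  apply: contrapT => nv; apply: Kn1; exists x => // v.
  by apply: contrapT => va; apply: nv; exists v => a va'; apply: va; exists a.
have /ex_normalized[a a1] : v - inner v x *: x != 0.
  by rewrite subr_eq0; apply/eqP/vx.
exists (a *: (v - inner v x *: x)) => //.
rewrite innerZr innerC innerBl innerZl norm1_inner // mulr1 subrr.
by rewrite rmorph0 mulr0.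
Qed.

End Inner.

(** * The q-numerical radius *)

Section Radius.
Variables (R : realType) (K : hilbertType R).
Implicit Types (x y : K) (A : K -> K) (q z : R[i]).

(** For linear A, the form of [bounded_op] that can be summed over the entries of
    an operator matrix. *)
Definition norm_bounded A := exists C : R[i], forall x, `|A x| <= C * `|x|.

Lemma linear_at0 A : linear A -> A 0 = 0.
Proof. by move=> /(_ (-1) 0 0); rewrite scaler0 addr0 scaleN1r addNr. Qed.

Lemma linear_addZ A a x y : linear A -> A (x + a *: y) = A x + a *: A y.
Proof. by move=> Alin; rewrite addrC Alin addrC. Qed.

Lemma linear_scale A a x : linear A -> A (a *: x) = a *: A x.
Proof.
by move=> Alin; have := linear_addZ a 0 x Alin; rewrite linear_at0 // !add0r.
Qed.

Lemma scalar_ofP A : linear A -> dim_one K -> forall x, A x = scalar_of A *: x.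
Proof.
move=> Alin [e e0 eK].
suff : exists c, forall x, A x = c *: x by apply: (xgetPex 0).
have [c Ae] := eK (A e); exists c => x; have [a ->] := eK x.
by rewrite linear_scale // Ae !scalerA mulrC.
Qed.

(** An unbounded range is harmless here: the supremum is then 0. *)
Lemma qnum_radius_ge0 q A : 0 <= qnum_radius q A.
Proof.
rewrite /qnum_radius; case: ifP => _.
  by rewrite mulr_ge0 ?Re_norm_ge0.
have [[[? [z qz _]] bnd]|nsup] := pselect
  (has_sup [set complex.Re `|z| | z in qnum_range q A]); last by rewrite sup_out.
have z_le : complex.Re `|z| <= sup [set complex.Re `|z| | z in qnum_range q A].
  by apply: ub_le_sup => //; exists z.
exact: le_trans (Re_norm_ge0 z) z_le.
Qed.

(** This holds in dimension one as well, where <Ax,y> = c<x,y> = cq matches the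
    convention; it thus spares later proofs a case distinction on the space
    containing the range. Boundedness of A makes the supremum meaningful. *)
Lemma le_qnum_radius q A z : linear A -> norm_bounded A ->
  qnum_range q A z -> `|z| <= (qnum_radius q A)%:C.
Proof.
move=> Alin [C AC] qz; rewrite /qnum_radius; case: ifPn => [/asboolP K1|_].
  have [x [y [_ _ <- ->]]] := qz.
  by rewrite (scalar_ofP Alin K1) innerZl Re_normMK normrM mulrC.
rewrite -Re_normK lecR; apply: ub_le_sup; last by exists z.
exists (complex.Re `|C|) => _ [_ [x [y [x1 y1 _ ->]]] <-].
rewrite -lecR !Re_normK (le_trans (inner_le _ _)) // y1 mulr1.
rewrite (le_trans (AC x)) // x1 mulr1 real_ler_norm //.
by apply: ger0_real; have := AC x; rewrite x1 mulr1; apply: le_trans.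
Qed.

End Radius.

(** * Comparison with the numerical radius *)

Section Comparison.
Variables (R : realType) (K : hilbertType R).
Implicit Types (x y z : K) (A : K -> K).

Lemma conj_real (r : R) : Num.conj r%:C = r%:C.
Proof. by rewrite conj_Creal // complex_real. Qed.

Lemma polarization A x z : linear A ->
  inner (A x) z *+ 4 =
    \sum_(k < 4) 'i%R ^+ k * inner (A (x + 'i%R ^+ k *: z)) (x + 'i%R ^+ k *: z).
Proof.
move=> Alin; rewrite !big_ord_recl big_ord0 /= !(linear_addZ _ _ _ Alin).
rewrite !(innerDl, innerDr, innerZl, innerZr) /bump /= expr0 expr1 addr0.
have i3 : 'i%R ^+ 3 = - 'i%R :> R[i] by rewrite exprS sqrCi mulrN1.
rewrite sqrCi i3 !rmorphN !rmorph1 /= !conjCi.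
move: (inner (A x) x) (inner (A x) z) (inner (A z) x) (inner (A z) z) => a b c d.
have ii : 'i%R * 'i%R = -1 :> R[i] by exact: sqrCi.
move: 'i%R ii => i ii.
ring : ii.
Qed.

Lemma parallelogram_sum x z :
  \sum_(k < 4) `|x + 'i%R ^+ k *: z| ^+ 2 = (`|x| ^+ 2 + `|z| ^+ 2) *+ 4.
Proof.
rewrite -!inner_normE !big_ord_recl big_ord0 /= /bump /= expr0 expr1 addr0.
rewrite -!inner_normE !(innerDl, innerDr, innerZl, innerZr).
have i3 : 'i%R ^+ 3 = - 'i%R :> R[i] by rewrite exprS sqrCi mulrN1.
rewrite sqrCi i3 !rmorphN !rmorph1 /= !conjCi.
have ii : 'i%R * 'i%R = -1 :> R[i] by exact: sqrCi.
move: 'i%R ii => i ii; ring : ii.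
Qed.

(** Polarization turns a bound on the diagonal values <Ax,x> into a bound on all
    values <Ax,z>. For unit vectors this says that the norm of A is at most twice
    its numerical radius; the non-homogeneous form is what polarization gives,
    and rescaling z recovers w |x| |z| up to the factor 2. *)
Lemma offdiagonal_le A (w : R[i]) x z : linear A -> 0 <= w ->
  (forall x, `|inner (A x) x| <= w * `|x| ^+ 2) ->
  `|inner (A x) z| <= w * (`|x| ^+ 2 + `|z| ^+ 2).
Proof.
move=> Alin w0 Aw.
rewrite -(ler_pMn2r (_ : 0 < 4)%N) // -normrMn polarization // -mulrnAr.
rewrite -parallelogram_sum mulr_sumr (le_trans (ler_norm_sum _ _ _)) //.
by apply: ler_sum => k _; rewrite normrM normrX normCi expr1n mul1r.
Qed.

Lemma num_radius_homogeneous A (w : R[i]) : linear A ->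
  (forall x, `|x| = 1 -> `|inner (A x) x| <= w) ->
  forall x, `|inner (A x) x| <= w * `|x| ^+ 2.
Proof.
move=> Alin Aw x; have [->|x0] := eqVneq x 0.
  by rewrite linear_at0 // -(scale0r (0 : K)) innerZl mul0r !normr0 normrZ normr0
    mul0r expr0n mulr0.
have nx0 : `|x| != 0 by rewrite normr_eq0.
have xE : x = `|x| *: (`|x|^-1 *: x) by rewrite scalerA mulfV // scale1r.
rewrite {1 2}xE linear_scale // innerZl innerZr !normrM norm_conjC normr_id mulrA.
rewrite -expr2 mulrC ler_wpM2r ?exprn_ge0 //; apply: Aw.
by rewrite normrZ ger0_norm ?invr_ge0 // mulVf.
Qed.

Section UnitInterval.
Variables (q : R) (q_ge0 : 0 <= q) (q_le1 : q <= 1).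
Let s : R := Num.sqrt (1 - q ^+ 2).

Let s_ge0 : 0 <= s. Proof. exact: sqrtr_ge0. Qed.

Let sqrs : s ^+ 2 = 1 - q ^+ 2.
Proof. by rewrite sqr_sqrtr // subr_ge0 expr_le1. Qed.

(** With e = 1 or e = -1, the vector q x + e s z is a unit vector whose inner
    product with x is q. *)
Lemma qnum_range_combination A x z (e : R) : e ^+ 2 = 1 ->
  `|x| = 1 -> `|z| = 1 -> inner x z = 0 ->
  qnum_range q%:C A (inner (A x) (q%:C *: x + (e * s)%:C *: z)).
Proof.
move=> e1 x1 z1 xz; exists x, (q%:C *: x + (e * s)%:C *: z).
have zx : inner z x = 0 by rewrite innerC xz rmorph0.
split=> //; last first.
  by rewrite innerDr !innerZr xz norm1_inner // mulr0 mulr1 addr0 conj_real.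
apply: inner_norm1; rewrite !(innerDl, innerDr, innerZl, innerZr) xz zx.
rewrite !norm1_inner // !conj_real !mulr0 !mulr1 addr0 add0r.
by rewrite -!rmorphM -rmorphD /= -!expr2 exprMn e1 sqrs mul1r addrC subrK.
Qed.

(** Adding the points of the q-numerical range given by q x + s z and q x - s z
    cancels the contribution of z and leaves 2 q <Ax,x>. *)
Lemma mul_num_radius_le A x : linear A -> norm_bounded A -> `|x| = 1 ->
  q%:C * `|inner (A x) x| <= (qnum_radius q%:C A)%:C.
Proof.
move=> Alin Abnd x1; have qC : `|q%:C| = q%:C by rewrite ger0_norm // lecR.
have [K1|Kn1] := pselect (dim_one K).
  rewrite /qnum_radius asboolT // (scalar_ofP Alin K1) innerZl norm1_inner //.
  by rewrite mulr1 Re_normMK qC.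
have [z z1 xz] := ex_unit_orthogonal x1 Kn1.
have rad e (e1 : e ^+ 2 = 1) := le_qnum_radius Alin Abnd
  (qnum_range_combination A e1 x1 z1 xz).
have := lerD (rad 1 (expr1n _ _)) (rad (-1) (sqrr_sign _ 1)).
rewrite -mulr2n => /(le_trans (ler_normD _ _)).
rewrite !innerDr !innerZr mulN1r mul1r !conj_real rmorphN mulNr addrACA subrr.
by rewrite addr0 -mulr2n normrMn ler_pMn2r // normrM qC.
Qed.

(** A unit vector y with <x,y> = q is q x + z with |z| = s, and
    |<Ax,z>| <= 2 s w by [offdiagonal_le] applied to the normalization of z. *)
Lemma qnum_radius_le A (w : R) : linear A -> 0 <= w ->
  (forall x, `|inner (A x) x| <= w%:C * `|x| ^+ 2) ->
  qnum_radius q%:C A <= (q + 2 * s) * w.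
Proof.
move=> Alin w0 Aw; have qC : `|q%:C| = q%:C by rewrite ger0_norm // lecR.
have rhs_ge0 : 0 <= (q + 2 * s) * w by rewrite mulr_ge0 // addr_ge0 // mulr_ge0.
rewrite /qnum_radius; case: ifPn => [/asboolP K1|_].
  rewrite -lecR Re_normMK qC.
  have [e /ex_normalized[a e1] _] := K1.
  have := Aw (a *: e); rewrite (scalar_ofP Alin K1) innerZl norm1_inner // e1.
  rewrite expr1n !mulr1 -Re_normK lecR => cw.
  rewrite -rmorphM lecR; apply: ler_pM => //; last by rewrite lerDl mulr_ge0.
  exact: Re_norm_ge0.
have [[z0 qz0]|nqz] := pselect (exists z : R[i], qnum_range q%:C A z); last first.
  rewrite (_ : [set _ | _ in _] = set0) ?sup0 // -subset0 => ? [z qz _].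
  by apply: nqz; exists z.
apply: ge_sup; first by exists (complex.Re `|z0|); exists z0.
move=> _ [_ [x [y [x1 y1 xy ->]]] <-]; rewrite -lecR Re_normK.
pose z := y - q%:C *: x.
have zs : `|z| = s%:C.
  apply/eqP; rewrite -(@eqrXn2 _ 2) ?lecR // -inner_normE /z.
  have yx : inner y x = q%:C by rewrite innerC xy conj_real.
  rewrite innerBl !innerBr !(innerZl, innerZr) yx xy.
  rewrite !norm1_inner // conj_real -rmorphXn /= sqrs.
  by rewrite rmorphB rmorphXn rmorph1 /=; apply/eqP; ring.
have -> : y = q%:C *: x + z by rewrite addrC subrK.
have xzw : `|inner (A x) z| <= (2 * s * w)%:C.
  (* z cannot be normalized when q = 1, but it is then 0. *)
  have [s0|s_neq0] := eqVneq s 0.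
    move/eqP: zs; rewrite s0 normr_eq0 => /eqP->.
    by rewrite linear0r normr0 mulr0 mul0r.
  have sC : s%:C != 0 by rewrite (inj_eq (@complexI _)).
  have sC0 : 0 <= s%:C by rewrite lecR.
  have -> : z = s%:C *: (s%:C^-1 *: z) by rewrite scalerA mulfV // scale1r.
  rewrite innerZr normrM conj_real ger0_norm //.
  apply: le_trans (ler_wpM2l sC0 (offdiagonal_le x (s%:C^-1 *: z) Alin _ Aw)) _.
    by rewrite lecR.
  rewrite normrZ ger0_norm ?invr_ge0 // zs mulVf // x1 expr1n !rmorphM rmorphMn.
  by rewrite rmorph1 /= le_eqVlt; apply/orP; left; apply/eqP; ring.
rewrite innerDr innerZr conj_real mulrDl rmorphD /=.
apply: le_trans (ler_normD _ _) (lerD _ xzw).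
rewrite normrM qC rmorphM; apply: ler_wpM2l; first by rewrite lecR.
by have := Aw x; rewrite x1 expr1n mulr1.
Qed.

End UnitInterval.
End Comparison.

(** * Intertwined operators *)

Section Decomposition.
Variables (R : realType) (K L : hilbertType R).

(** The q-numerical range of B lies in that of A. When K has dimension one this
    inclusion says nothing for q < 1, the range of B being empty; the
    conventional value q|c| is reached through [mul_num_radius_le] instead, as
    c is the value <A(Je),Je> for a unit vector e. *)
Lemma qnum_radius_isometry (q : R) (A : L -> L) (B : K -> K) (J : K -> L) :
  0 <= q -> q <= 1 -> linear A -> norm_bounded A -> linear B ->
  (forall x y, inner (J x) (J y) = inner x y) ->
  (forall x, A (J x) = J (B x)) ->
  qnum_radius q%:C B <= qnum_radius q%:C A.
Proof.
move=> q0 q1 Alin Abnd Blin Jiso AJ.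
have J1 x : `|x| = 1 -> `|J x| = 1.
  by move=> /norm1_inner x1; apply: inner_norm1; rewrite Jiso.
rewrite {1}/qnum_radius; case: ifPn => [/asboolP K1|_].
  have [e /ex_normalized[a e1] _] := K1.
  have := mul_num_radius_le q0 q1 Alin Abnd (J1 _ e1).
  rewrite AJ Jiso (scalar_ofP Blin K1) innerZl norm1_inner // mulr1 -lecR.
  by rewrite Re_normMK (ger0_norm (_ : 0 <= q%:C)) // lecR.
have [[z0 qz0]|nqz] := pselect (exists z : R[i], qnum_range q%:C B z); last first.
  rewrite (_ : [set _ | _ in _] = set0) ?sup0 ?qnum_radius_ge0 //.
  by rewrite -subset0 => ? [z qz _]; apply: nqz; exists z.
apply: ge_sup; first by exists (complex.Re `|z0|); exists z0.
move=> _ [z [x [y [x1 y1 xy ->]]] <-]; rewrite -lecR Re_normK.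
apply: le_qnum_radius => //; exists (J x), (J y).
by split; rewrite ?J1 // ?AJ ?Jiso.
Qed.

(** P k is adjoint to J k and the J k (P k y) sum to y, so that <Ay,y> is the sum
    of the <B_k u_k,u_k> and |y|^2 that of the |u_k|^2, with u_k = P k y. *)
Lemma num_radius_decomposition (I : finType) (A : L -> L) (B : I -> K -> K)
    (J : I -> K -> L) (P : I -> L -> K) (w : R[i]) :
  linear A ->
  (forall k u, A (J k u) = J k (B k u)) ->
  (forall k u y, inner (J k u) y = inner u (P k y)) ->
  (forall y, \sum_k J k (P k y) = y) ->
  (forall k u, `|inner (B k u) u| <= w * `|u| ^+ 2) ->
  forall y, `|inner (A y) y| <= w * `|y| ^+ 2.
Proof.
move=> Alin AJ JP PK Bw y.
have AD u v : A (u + v) = A u + A v by have := linear_addZ 1 u v Alin; rewrite !scale1r.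
have -> : A y = \sum_k J k (B k (P k y)).
  by rewrite -{1}(PK y) (big_morph A AD (linear_at0 Alin)); apply: eq_bigr => k _; rewrite AJ.
have -> : `|y| ^+ 2 = \sum_k `|P k y| ^+ 2.
  rewrite -inner_normE -{1}(PK y) inner_suml; apply: eq_bigr => k _.
  by rewrite JP inner_normE.
rewrite inner_suml mulr_sumr (le_trans (ler_norm_sum _ _ _)) //.
by apply: ler_sum => k _; rewrite JP.
Qed.

End Decomposition.

(** * Block operators on a direct sum *)

Section BlockOperators.
Variables (R : realType) (n : nat) (H : hilbertType R).
Implicit Types S : 'I_n -> 'I_n -> H -> H.

Lemma opmx_act_linear S : (forall i j, linear (S i j)) -> linear (opmx_act S).
Proof.
move=> Slin a x y; apply/ffunP => i; rewrite !ffunE scaler_sumr -big_split /=.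
by apply: eq_bigr => j _; rewrite !ffunE Slin.
Qed.

Lemma opmx_act_norm_bounded S :
  (forall i j, norm_bounded (S i j)) -> norm_bounded (opmx_act S).
Proof.
move=> Sbnd.
have /choice[C' SC'] : forall ij, norm_bounded (S ij.1 ij.2) by [].
pose C i j := C' (i, j); have SC i j v : `|S i j v| <= C i j * `|v| := SC' (i, j) v.
exists (\sum_i \sum_j `|C i j|) => x; rewrite (le_trans (hsum_norm_le _)) //.
rewrite mulr_suml; apply: ler_sum => i _; rewrite ffunE mulr_suml.
rewrite (le_trans (ler_norm_sum _ _ _)) //; apply: ler_sum => j _.
have Cx : C i j * `|x j| <= `|C i j| * `|x j|.
  have := SC i j (x j); have [->|x0] := eqVneq `|x j| 0; first by rewrite !mulr0.
  move=> /(le_trans (normr_ge0 _)); rewrite pmulr_lge0 ?lt_def ?x0 ?normr_ge0 //.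
  by move=> /ger0_norm->.
by rewrite (le_trans (SC i j _)) // (le_trans Cx) // ler_wpM2l // hsum_norm_ge.
Qed.

End BlockOperators.

(** * Geometric vectors and imaginary circulants *)

Section Fourier.
Variables (R : realType) (n : nat) (H : hilbertType R).
Hypothesis n_gt0 : (0 < n)%N.

(** Makes the geometric sequence of a scalar of modulus 1 a unit vector. *)
Definition fourier_weight : R[i] := (sqrtC n%:R)^-1.

Definition geom_embed (l : R[i]) (x : H) : hsum n H :=
  [ffun i : 'I_n => (fourier_weight * l ^+ i) *: x].

Definition geom_coord (l : R[i]) (y : hsum n H) : H :=
  \sum_(i < n) Num.conj (fourier_weight * l ^+ i) *: y i.

Lemma fourier_weight_sqr : fourier_weight * Num.conj fourier_weight = n%:R^-1.
Proof.
rewrite -normCK /fourier_weight ger0_norm ?invr_ge0 ?sqrtC_ge0 ?ler0n //.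
by rewrite exprVn sqrtCK.
Qed.

Lemma geom_embed_adjoint l x y : inner (geom_embed l x) y = inner x (geom_coord l y).
Proof.
rewrite inner_sumr; apply: eq_bigr => i _.
by rewrite ffunE innerZl innerZr conjCK.
Qed.

Lemma geom_embedK l : `|l| = 1 -> cancel (geom_embed l) (geom_coord l).
Proof.
move=> l1 x; rewrite /geom_coord.
under eq_bigr => i _ do rewrite ffunE scalerA -normCKC normrM normrX l1 expr1n
  mulr1 normCK fourier_weight_sqr.
rewrite sumr_const card_ord -scaler_nat scalerA mulfV ?scale1r //.
by rewrite pnatr_eq0 -lt0n.
Qed.

Lemma geom_embed_isometry l x y : `|l| = 1 ->
  inner (geom_embed l x) (geom_embed l y) = inner x y.
Proof. by move=> l1; rewrite geom_embed_adjoint geom_embedK. Qed.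

(** Each row of a circulant thus lists every S_j once, which allows a sum over a
    row to be reindexed by the S_j. *)
Lemma circ_index_inj (i : 'I_n) : injective (circ_index i).
Proof.
move=> j k /(congr1 val) /= /eqP; rewrite eqn_modDr !modn_small // => /eqP.
exact: val_inj.
Qed.

(** In row i the operator S_m meets the entry of index i + m of the geometric
    sequence; when i + m wraps around n, the imaginary unit in front of S_m
    supplies the missing factor l^n. *)
Lemma circ_geom_embed (S : 'I_n -> {linear H -> H}) (l : R[i]) (x : H) :
  l ^+ n = 'i%C ->
  opmx_act (circ_i (fun j => S j)) (geom_embed l x) =
  geom_embed l (\sum_(j < n) l ^+ j *: S j x).
Proof.
move=> ln; apply/ffunP => i; rewrite !ffunE scaler_sumr.
rewrite [RHS](reindex_inj (@circ_index_inj i)); apply: eq_bigr => j _.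
rewrite ffunE /circ_i scalerA -mulrA -exprD; case: leqP => ij.
  rewrite linearZ; congr (_ * _ ^+ _ *: _) => /=.
  have -> : (j + (n - i) = j - i + n)%N by have := ltn_ord i; lia.
  by rewrite modnDr modn_small; have := ltn_ord j; lia.
have wrap : (i + (j + (n - i)) %% n = n + j)%N.
  by rewrite modn_small; have := ltn_ord i; lia.
by rewrite linearZ /= scalerA mulrCA wrap exprD ln.
Qed.

(** The hypothesis is the orthogonality of the rows of the matrix of the l_k^i;
    the sum over k of the projections has this matrix times its adjoint, divided
    by n, as its coefficients. *)
Lemma geom_embed_complete (l : 'I_n -> R[i]) :
  (forall i j : 'I_n,
    \sum_k l k ^+ i * Num.conj (l k ^+ j) = if i == j then n%:R else 0) ->
  forall y, \sum_k geom_embed (l k) (geom_coord (l k) y) = y.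
Proof.
move=> lorth y; apply/ffunP => i; rewrite sum_ffunE.
under eq_bigr => k _.
  rewrite ffunE scaler_sumr; under eq_bigr => j _.
    rewrite scalerA rmorphM mulrACA fourier_weight_sqr. over.
  over.
rewrite exchange_big /= (bigD1 i) //= -scaler_suml -mulr_sumr lorth eqxx.
rewrite mulVf ?pnatr_eq0 -?lt0n // scale1r big1 ?addr0 // => j ji.
by rewrite -scaler_suml -mulr_sumr lorth eq_sym (negPf ji) mulr0 scale0r.
Qed.

End Fourier.

(** * Roots of the imaginary unit *)

Section RootsOfUnity.
Variable R : realType.
Implicit Types (t u : R) (n : nat).

Lemma expiD t u : expi (t + u) = expi t * expi u.
Proof. by rewrite /expi cosD sinD; congr (_ +i* _); rewrite addrC [X in X + _]mulrC. Qed.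

Lemma expiMn t n : expi (t *+ n) = expi t ^+ n.
Proof.
elim: n => [|n IH]; first by rewrite mulr0n expr0 /expi cos0 sin0.
by rewrite mulrS exprS expiD IH.
Qed.

Lemma norm_expi t : `|expi t| = 1.
Proof. by rewrite normc_def /expi /= cos2Dsin2 sqrtr1. Qed.

Lemma expi_pihalf : expi (pi / 2 : R) = 'i%C.
Proof. by rewrite /expi cos_pihalf sin_pihalf. Qed.

Lemma expi_2pi : expi (2 * pi : R) = 1.
Proof. by rewrite mulrC mulr_natr /expi cos2pi sin2pi. Qed.

(** The double angle makes the real part 1 - 2 sin(t)^2, hence less than 1. *)
Lemma expi_neq1 t : 0 < t < pi -> expi (t *+ 2) != 1.
Proof.
move=> /sin_gt0_pi st; apply/eqP => /(congr1 (@complex.Re R)) /=.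
rewrite cos_mulr2n => c1; have := cos2Dsin2 t; nra.
Qed.

Lemma expi_prim_root n : (0 < n)%N -> n.-primitive_root (expi (2 * pi / n%:R : R)).
Proof.
move=> n0; have nR : 0 < n%:R :> R by rewrite ltr0n.
apply/andP; split=> //; apply/forallP => m; rewrite unity_rootE -expiMn.
have [/eqP mn|mn] := boolP (m.+1 == n).
  have full_turn : 2 * pi / n%:R *+ n = 2 * pi :> R.
    by rewrite -[LHS]mulr_natr divfK ?gt_eqF.
  by rewrite mn full_turn expi_2pi eqxx.
have -> : 2 * pi / n%:R *+ m.+1 = (pi * m.+1%:R / n%:R) *+ 2 :> R.
  by rewrite -[LHS]mulr_natr -[RHS]mulr_natr; field; rewrite gt_eqF.
apply/eqP/negbTE/expi_neq1.
rewrite divr_gt0 ?mulr_gt0 ?pi_gt0 //= ltr_pdivrMr // ltr_pM2l ?pi_gt0 //.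
by rewrite ltr_nat ltn_neqAle mn ltn_ord.
Qed.

(** Off the diagonal this is a multiple of a full geometric sum whose ratio
    w^(i-j) is an n-th root of unity other than 1. The twist a only contributes
    a factor of modulus 1. *)
Lemma twisted_root_orthogonality n (a w : R[i]) : `|a| = 1 ->
  n.-primitive_root w -> forall i j : 'I_n,
  \sum_(k < n) (a * w ^+ k) ^+ i * Num.conj ((a * w ^+ k) ^+ j) =
    if i == j then n%:R else 0.
Proof.
move=> a1 wn i j; have n_gt0 := prim_order_gt0 wn.
have w1 : `|w| = 1.
  by apply/eqP; rewrite -(@pexpr_eq1 _ _ n) // -normrX prim_expr_order // normr1.
have ww m : w ^+ m * Num.conj (w ^+ m) = 1 by rewrite -normCK normrX w1 !expr1n.
have aa m : a ^+ m * Num.conj (a ^+ m) = 1 by rewrite -normCK normrX a1 !expr1n.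
pose r := w ^+ i * Num.conj (w ^+ j).
have -> : \sum_(k < n) (a * w ^+ k) ^+ i * Num.conj ((a * w ^+ k) ^+ j) =
    a ^+ i * Num.conj (a ^+ j) * \sum_(k < n) r ^+ k.
  rewrite mulr_sumr; apply: eq_bigr => k _.
  by rewrite !exprMn !rmorphM mulrACA -!rmorphXn /= -!exprM ![(k * _)%N]mulnC.
case: eqP => [ij|/eqP ij].
  rewrite /r ij aa mul1r ww; under eq_bigr do rewrite expr1n.
  by rewrite sumr_const card_ord.
have r1 : r != 1.
  apply: contra ij => /eqP r1; rewrite -val_eqE /=.
  have : w ^+ i == w ^+ j.
    by rewrite -[w ^+ j]mul1r -r1 /r -mulrA [_ * w ^+ j]mulrC ww mulr1.
  by rewrite (eq_prim_root_expr wn) !modn_small.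
have wn1 m : w ^+ m ^+ n = 1 by rewrite exprAC (prim_expr_order wn) expr1n.
have rn : r ^+ n = 1 by rewrite exprMn -rmorphXn /= !wn1 rmorph1 mulr1.
have /eqP := subrX1 r n; rewrite rn subrr eq_sym mulf_eq0 subr_eq0 (negPf r1) /=.
by move=> /eqP->; rewrite mulr0.
Qed.

End RootsOfUnity.

(** * Imaginary circulant operator matrices *)

Lemma bounded_op_norm_bounded (R : realType) (K : hilbertType R)
    (A : {linear K -> K}) : bounded_op A -> norm_bounded A.
Proof. by move=> /linear_boundedP/filter_ex. Qed.

Lemma circ_i_norm_bounded (R : realType) (n : nat) (H : hilbertType R)
    (S : 'I_n -> H -> H) (i j : 'I_n) :
  (forall m, norm_bounded (S m)) -> norm_bounded (circ_i S i j).
Proof.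
move=> Sbnd; have [C SC] := Sbnd (circ_index i j); exists C => x.
rewrite /circ_i; case: ifP => _ //.
by rewrite normrZ normCi mul1r.
Qed.

Lemma circ_i_linear (R : realType) (n : nat) (H : hilbertType R)
    (S : 'I_n -> {linear H -> H}) (i j : 'I_n) :
  linear (circ_i (fun m => S m) i j).
Proof.
move=> a x y; rewrite /circ_i; case: ifP => _; rewrite linearP //.
by rewrite scalerDr !scalerA mulrC.
Qed.

Theorem theorem4p4 (R : realType) (H : hilbertType R) (n : nat)
    (n_gt0 : (0 < n)%N) (S : 'I_n -> {linear H -> H})
    (S_bounded : forall j, bounded_op (S j))
    (q : R) (q_gt0 : 0 < q) (q_le1 : q <= 1) :
  let alpha : R[i] := expi (pi / (2 * n%:R)) in
  let omega : R[i] := expi (2 * pi / n%:R) in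
  let T (k : nat) : H -> H :=
    fun x => \sum_(j < n) (alpha * omega ^+ k) ^+ j *: S j x in
  let M : R := \big[Num.max/0]_(k < n) qnum_radius q%:C (T k) in
  let Scirc : hsum n H -> hsum n H := opmx_act (circ_i (fun j => S j)) in
  M <= qnum_radius q%:C Scirc <= (q + 2 * Num.sqrt (1 - q ^+ 2)) / q * M.
Proof.
pose alpha : R[i] := expi (pi / (2 * n%:R)).
pose omega : R[i] := expi (2 * pi / n%:R).
pose T (k : nat) (x : H) : H := \sum_(j < n) (alpha * omega ^+ k) ^+ j *: S j x.
pose M : R := \big[Num.max/0]_(k < n) qnum_radius q%:C (T k).
pose Scirc : hsum n H -> hsum n H := opmx_act (circ_i (fun j => S j)).
change (M <= qnum_radius q%:C Scirc <= (q + 2 * Num.sqrt (1 - q ^+ 2)) / q * M).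
have q_ge0 := ltW q_gt0.
pose l (k : 'I_n) : R[i] := alpha * omega ^+ k.
have Sbnd j : norm_bounded (S j) := bounded_op_norm_bounded (S_bounded j).
have nR : n%:R != 0 :> R by rewrite pnatr_eq0 -lt0n.
have Scirc_lin : linear Scirc by apply: opmx_act_linear; exact: circ_i_linear.
have Scirc_bnd : norm_bounded Scirc.
  by apply: opmx_act_norm_bounded => i j; exact: circ_i_norm_bounded.
have T_lin k : linear (T k).
  move=> a x y; rewrite /T scaler_sumr -big_split /=; apply: eq_bigr => j _.
  by rewrite linearP scalerDr !scalerA mulrC.
have T_bnd k : norm_bounded (T k).
  have /choice[C SC] := Sbnd.
  exists (\sum_(j < n) `|(alpha * omega ^+ k) ^+ j| * C j) => x; rewrite mulr_suml.
  rewrite (le_trans (ler_norm_sum _ _ _)) //; apply: ler_sum => j _.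
  by rewrite normrZ -mulrA ler_wpM2l.
have omega_prim : n.-primitive_root omega by exact: expi_prim_root.
have l_norm k : `|l k| = 1 by rewrite normrM normrX !norm_expi expr1n mulr1.
have l_root k : l k ^+ n = 'i%C.
  rewrite exprMn exprAC (prim_expr_order omega_prim) expr1n mulr1 -expiMn.
  rewrite -expi_pihalf; congr expi; rewrite -mulr_natr; field; exact: nR.
have intertwine k x : Scirc (geom_embed n (l k) x) = geom_embed n (l k) (T k x).
  exact: circ_geom_embed.
apply/andP; split.
  apply: bigmax_le => [|k _]; first exact: qnum_radius_ge0.
  apply: (qnum_radius_isometry (J := geom_embed n (l k))) => // x y.
  exact: geom_embed_isometry.
have M_ge0 : 0 <= M by exact: bigmax_ge_id.
rewrite -mulrA [q^-1 * M]mulrC.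
apply: qnum_radius_le => //; first by rewrite divr_ge0.
apply: (num_radius_decomposition (I := 'I_n) (B := fun k => T k)
  (J := fun k => geom_embed n (l k)) (P := fun k => @geom_coord R n H (l k))) => //.
- by move=> k u y; exact: geom_embed_adjoint.
- apply: geom_embed_complete => //.
  by apply: twisted_root_orthogonality => //; exact: norm_expi.
move=> k; apply: num_radius_homogeneous => // u u1.
(* T_k has numerical radius at most w_q(T_k) / q, hence at most M / q. *)
have Tk_le : qnum_radius q%:C (T k) <= M.
  exact: (le_bigmax 0 (fun k : 'I_n => qnum_radius q%:C (T k)) k).
have qC_gt0 : 0 < q%:C :> R[i] by rewrite ltcR.
have qM : q%:C * (M / q)%:C = M%:C.
  by rewrite -rmorphM; congr (_%:C); field; rewrite gt_eqF.
rewrite -(ler_pM2l qC_gt0) qM.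
by rewrite (le_trans (mul_num_radius_le q_ge0 q_le1 (T_lin k) (T_bnd k) u1)) // lecR.
Qed.
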